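(* Let $K$ be a field and suppose the Stanley-Reisner ring $R=K[\Delta]$ is a $T$-space. Let $\mathscr D=D(R;K)$. Then for any $f\in R$ and any $\mathscr D$-module $M$, if $M$ is holonomic then so is $M_f$.
   Context: Let $S=K[x_1,\dots,x_n]$. A simplicial complex $\Delta$ on the vertex set $V=\{x_1,\dots,x_n\}$ is a collection of subsets of $V$ (called faces, including $\emptyset$) closed under taking subsets; without loss of generality all singletons $\{x_i\}$ belong to $\Delta$. Facets are the faces maximal under inclusion. The face ideal is $I_\Delta=(x_{i_1}\cdots x_{i_s}\mid \{x_{i_1},\dots,x_{i_s}\}\notin\Delta)\subset S$ and $K[\Delta]=S/I_\Delta$. $\Delta$ (or $K[\Delta]$) is a $T$-space if for every pair of faces $F,G\in\Delta$ with $G\not\subseteq F$ there exists a facet $H$ of $\Delta$ with $F\subseteq H$ and $G\not\subseteq H$. $\mathscr D=D(R;K)$ is the (Grothendieck) ring of $K$-linear differential operators on $R$; ''$\mathscr D$-module'' means left $\mathscr D$-module. For a $\mathscr D$-module $M$, the localization $M_f$ carries the natural $\mathscr D$-module structure inherited from $M$ (so that $M\to M_f$ is $\mathscr D$-linear). On $S$, $\partial_i^{t}=\frac1{t!}\frac{\partial^t}{\partial x_i^t}$ is the divided power operator, linear over $K[x_1,\dots,\widehat{x_i},\dots,x_n]$ with $x_i^v\mapsto\binom vt x_i^{v-t}$ (any characteristic), and $\mathbf x^{\mathbf a}\underline\partial^{\mathbf t}=x_1^{a_1}\cdots x_n^{a_n}\partial_1^{t_1}\cdots\partial_n^{t_n}$.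 With $J=I_\Delta$ and $\mathscr I(J)=\{\delta\in D(S;K)\mid\delta(J)\subset J\}$ one identifies $\mathscr D\cong\mathscr I(J)/J D(S;K)$. The Bernstein filtration $\mathscr F_0\subset\mathscr F_1\subset\cdots\subset\mathscr D$ is: $\mathscr F_j$ is the image in $\mathscr I(J)/JD(S;K)=\mathscr D$ of those elements of $\mathscr I(J)$ lying in the $K$-span of $\{\mathbf x^{\mathbf a}\underline\partial^{\mathbf t}\mid a_1+\cdots+a_n+t_1+\cdots+t_n\le j\}$. A $K$-filtration on a $\mathscr D$-module $M$ is an ascending chain of $K$-submodules $\mathscr G_0\subset\mathscr G_1\subset\cdots$ of $M$ with $\bigcup_i\mathscr G_i=M$ and $\mathscr F_j\mathscr G_i\subset\mathscr G_{i+j}$ for all $i,j$. $M$ is holonomic if it has a $K$-filtration $\mathscr G$ and a constant $C$ with $\dim_K\mathscr G_i\le C i^r$ for all $i$, where $r=\dim R$. *)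

(* Defs.v *)
From HB Require Import structures.
From mathcomp Require Import all_boot all_order all_algebra.
From mathcomp Require Import ring_quotient generic_quotient.
From mathcomp Require Import mpoly.
From mathcomp Require Import boolp zify.

Set Implicit Arguments.
Unset Strict Implicit.
Unset Printing Implicit Defensive.

Import GRing.Theory.
Local Open Scope ring_scope.
Local Open Scope quotient_scope.

(* [diff_ord d h] : h has order < d, that is h is killed by every d-fold
   iterated commutator with multiplications; the only operator of order < 0
   is 0, and those of order < 1 are the A-linear maps. *)
Fixpoint diff_ord (A : pzRingType) (d : nat) (h : A -> A) : Prop :=
  if d is d'.+1 then forall a : A, diff_ord d' (fun x => h (a * x) - a * h x)
  else forall x, h x = 0.

Definition is_diffop (K : fieldType) (A : comAlgType K) (h : A -> A) : Prop :=
  linear h /\ exists d, diff_ord d h.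

Record diffop (K : fieldType) (A : comAlgType K) := Diffop {
  diffop_fun :> A -> A;
  _ : `[< is_diffop diffop_fun >]
}.

Section DiffopRing.
Variables (K : fieldType) (A : comAlgType K).

HB.instance Definition _ := [isSub for @diffop_fun K A].
HB.instance Definition _ := [Choice of diffop A by <:].

Implicit Types d e : diffop A.

Lemma diffopP d : is_diffop d.
Proof. by case: d => h /= /asboolP. Qed.

Lemma diffopE (d e : diffop A) : d =1 e -> d = e.
Proof. by move=> de; apply: val_inj; apply: funext. Qed.

Lemma diff_ord_ext k (h h' : A -> A) : h =1 h' -> diff_ord k h -> diff_ord k h'.
Proof.
elim: k h h' => [|k IH] h h' hh' /= H; first by move=> x; rewrite -hh'.
by move=> a; apply: (IH _ _ _ (H a)) => x; rewrite !hh'.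
Qed.

Lemma diff_ord0 k : diff_ord k (fun=> 0 : A).
Proof.
elim: k => [|k IH] //= a.
by apply: (diff_ord_ext _ IH) => x; rewrite mulr0 subrr.
Qed.

Lemma diff_ordS k (h : A -> A) : diff_ord k h -> diff_ord k.+1 h.
Proof.
elim: k h => [|k IH] h H.
  by move=> a x; rewrite !H mulr0 subrr.
by move=> a; apply: IH; apply: H.
Qed.

Lemma diff_ord_le k l (h : A -> A) : (k <= l)%N -> diff_ord k h -> diff_ord l h.
Proof.
move=> /subnK <- H; elim: (l - k)%N => [|j IH] //.
by rewrite addSn; apply: diff_ordS.
Qed.

Lemma diff_ordD k (h h' : A -> A) :
  diff_ord k h -> diff_ord k h' -> diff_ord k (fun x => h x + h' x).
Proof.
elim: k h h' => [|k IH] h h' /= H H'; first by move=> x; rewrite H H' addr0.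
move=> a; apply: (diff_ord_ext _ (IH _ _ (H a) (H' a))) => x.
by rewrite mulrDr opprD addrACA.
Qed.

Lemma diff_ordN k (h : A -> A) : diff_ord k h -> diff_ord k (fun x => - h x).
Proof.
elim: k h => [|k IH] h /= H; first by move=> x; rewrite H oppr0.
move=> a; apply: (diff_ord_ext _ (IH _ (H a))) => x.
by rewrite mulrN opprB opprK; exact: addrC.
Qed.

Lemma diff_ordZ k c (h : A -> A) : diff_ord k h -> diff_ord k (fun x => c *: h x).
Proof.
elim: k h => [|k IH] h /= H; first by move=> x; rewrite H scaler0.
move=> a; apply: (diff_ord_ext _ (IH _ (H a))) => x.
by rewrite scalerBr scalerAr.
Qed.

Lemma diff_ord_comp k l (h h' : A -> A) :
    (forall x y, h (x - y) = h x - h y) ->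
  diff_ord k h -> diff_ord l h' -> diff_ord (k + l) (fun x => h (h' x)).
Proof.
have [m] := ubnP (k + l)%N; elim: m k l h h' => [|m IH] // k l h h' lt_m hB.
have h0 : h 0 = 0 by have := hB 0 0; rewrite !subrr.
case: k lt_m => [|k] lt_m H H'.
  by apply: (diff_ord_le (leq0n _)) => x; apply: H.
case: l lt_m H' => [|l] lt_m H'.
  apply: (diff_ord_le (leq0n _)) => x; by rewrite H' h0.
rewrite addSn /= => a.
have H1 : diff_ord (k + l.+1) (fun x => h (h' (a * x) - a * h' x)).
  rewrite addnS -addSn; apply: IH => //; by rewrite addnS ltnS in lt_m.
have H2 : diff_ord (k + l.+1) (fun x => h (a * h' x) - a * h (h' x)).
  apply: (IH _ _ (fun x => h (a * x) - a * h x)) => //.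
    by move=> x y; rewrite mulrBr !hB mulrBr !opprD opprK addrACA.
apply: (diff_ord_ext _ (diff_ordD H1 H2)) => x.
by rewrite hB addrA subrK.
Qed.

Lemma is_diffopB (h : A -> A) :
  is_diffop h -> forall x y, h (x - y) = h x - h y.
Proof. by case=> lin_h _ x y; rewrite addrC -scaleN1r lin_h scaleN1r addrC. Qed.

Lemma diffop0_subproof : `[< is_diffop (fun=> 0 : A) >].
Proof.
apply/asboolP; split; last by exists 0%N.
by move=> c x y; rewrite scaler0 addr0.
Qed.

Lemma diffopN_subproof d : `[< is_diffop (fun x => - d x) >].
Proof.
have [lin_d [k ord_d]] := diffopP d.
apply/asboolP; split; last by exists k; apply: diff_ordN.
by move=> c x y; rewrite lin_d opprD scalerN.
Qed.

Lemma diffopD_subproof d e : `[< is_diffop (fun x => d x + e x) >].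
Proof.
have [lin_d [k ord_d]] := diffopP d; have [lin_e [l ord_e]] := diffopP e.
apply/asboolP; split.
  by move=> c x y; rewrite lin_d lin_e scalerDr addrACA.
exists (maxn k l); apply: diff_ordD.
  exact: diff_ord_le (leq_maxl _ _) ord_d.
exact: diff_ord_le (leq_maxr _ _) ord_e.
Qed.

Lemma diffopZ_subproof c d : `[< is_diffop (fun x => c *: d x) >].
Proof.
have [lin_d [k ord_d]] := diffopP d.
apply/asboolP; split; last by exists k; apply: diff_ordZ.
by move=> b x y; rewrite lin_d scalerDr !scalerA mulrC.
Qed.

Lemma diffop_mul_subproof (a : A) : `[< is_diffop (fun x => a * x) >].
Proof.
apply/asboolP; split; first by move=> c x y; rewrite mulrDr scalerAr.
by exists 1%N => b x; rewrite mulrCA subrr.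
Qed.

Lemma diffop_comp_subproof d e : `[< is_diffop (fun x => d (e x)) >].
Proof.
have dB := is_diffopB (diffopP d).
have [lin_d [k ord_d]] := diffopP d; have [lin_e [l ord_e]] := diffopP e.
apply/asboolP; split; first by move=> c x y; rewrite lin_e lin_d.
by exists (k + l)%N; apply: diff_ord_comp.
Qed.

Lemma diffop_id_subproof : `[< is_diffop (fun x : A => x) >].
Proof.
apply/asboolP; split => //; exists 1%N => b x; by rewrite subrr.
Qed.

Definition diffop0 := Diffop diffop0_subproof.
Definition diffopN d := Diffop (diffopN_subproof d).
Definition diffopD d e := Diffop (diffopD_subproof d e).
Definition diffopZ c d := Diffop (diffopZ_subproof c d).
Definition diffop_id := Diffop diffop_id_subproof.
Definition diffop_comp d e := Diffop (diffop_comp_subproof d e).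

Definition diffop_mul a := Diffop (diffop_mul_subproof a).

Fact diffop_addA : associative diffopD.
Proof. by move=> d e g; apply: diffopE => x /=; rewrite addrA. Qed.
Fact diffop_addC : commutative diffopD.
Proof. by move=> d e; apply: diffopE => x /=; rewrite addrC. Qed.
Fact diffop_add0 : left_id diffop0 diffopD.
Proof. by move=> d; apply: diffopE => x /=; rewrite add0r. Qed.
Fact diffop_addN : left_inverse diffop0 diffopN diffopD.
Proof. by move=> d; apply: diffopE => x /=; rewrite addNr. Qed.

HB.instance Definition _ := GRing.isZmodule.Build (diffop A)
  diffop_addA diffop_addC diffop_add0 diffop_addN.

Fact diffop_compA : associative diffop_comp.
Proof. by move=> d e g; apply: diffopE. Qed.
Fact diffop_comp1l : left_id diffop_id diffop_comp.
Proof. by move=> d; apply: diffopE. Qed.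
Fact diffop_comp1r : right_id diffop_id diffop_comp.
Proof. by move=> d; apply: diffopE. Qed.
Fact diffop_compDl : left_distributive diffop_comp +%R.
Proof. by move=> d e g; apply: diffopE. Qed.
Fact diffop_compDr : right_distributive diffop_comp +%R.
Proof.
move=> d e g; apply: diffopE => x /=; have [lin_d _] := diffopP d.
by rewrite -[e x]scale1r lin_d !scale1r.
Qed.
Fact diffop_1neq0 : diffop_id != 0 :> diffop A.
Proof.
apply/eqP => /(congr1 (fun d : diffop A => d 1)) /= /eqP.
by rewrite oner_eq0.
Qed.

HB.instance Definition _ := GRing.Zmodule_isNzRing.Build (diffop A)
  diffop_compA diffop_comp1l diffop_comp1r
  diffop_compDl diffop_compDr diffop_1neq0.

Fact diffop_scaleA a b d : diffopZ a (diffopZ b d) = diffopZ (a * b) d.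
Proof. by apply: diffopE => x /=; rewrite scalerA. Qed.
Fact diffop_scale1 : left_id 1 diffopZ.
Proof. by move=> d; apply: diffopE => x /=; rewrite scale1r. Qed.
Fact diffop_scaleDr : right_distributive diffopZ +%R.
Proof. by move=> c d e; apply: diffopE => x /=; rewrite scalerDr. Qed.
Fact diffop_scaleDl d : {morph diffopZ^~ d : a b / a + b}.
Proof. by move=> a b; apply: diffopE => x /=; rewrite scalerDl. Qed.

HB.instance Definition _ := GRing.Zmodule_isLmodule.Build K (diffop A)
  diffop_scaleA diffop_scale1 diffop_scaleDr diffop_scaleDl.

Fact diffop_scaleAl c d e : c *: (d * e) = c *: d * e.
Proof. by apply: diffopE. Qed.

HB.instance Definition _ := GRing.Lmodule_isLalgebra.Build K (diffop A)
  diffop_scaleAl.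

Fact diffop_scaleAr c d e : c *: (d * e) = d * (c *: e).
Proof.
apply: diffopE => x /=; have [lin_d _] := diffopP d.
have d0 : d 0 = 0 by have := is_diffopB (diffopP d) 0 0; rewrite !subrr.
by rewrite -[c *: e x]addr0 lin_d d0 addr0.
Qed.

HB.instance Definition _ := GRing.Lalgebra_isAlgebra.Build K (diffop A)
  diffop_scaleAr.

End DiffopRing.

(* M_f consists of the fractions m/f^k, with m/f^k = m'/f^k' iff
   f^j (f^k' m - f^k m') = 0 for some j.  The powers of f form a left Ore set
   of D(A;K), and d (m/f^k) = (d' m)/f^j whenever f^j d = d' f^k in D(A;K): see
   [diffop_ore] for the existence of d' and j, and [lfrac_scale] for the
   independence of their choice.  This is the only D(A;K)-module structure on
   M_f that extends the one over A and makes m |-> m/1 D(A;K)-linear. *)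
Section Localization.
Variables (K : fieldType) (A : comAlgType K) (f : A).

Local Notation D := (diffop A).
Local Notation s := (diffop_mul f : diffop A).

Lemma diffop_ore1 (d : D) : exists p : D * nat, s ^+ p.2 * d = p.1 * s.
Proof.
have [_ [k]] := diffopP d; elim: k d => [|k IH] d ord_d.
  exists (0, 0%N); rewrite /= mul1r mul0r.
  by apply: diffopE => x; rewrite ord_d.
have [|[d' j] /= dj] := IH (d * s - s * d).
  exact: ord_d.
exists (s ^+ j * d - d', j.+1).
rewrite /= mulrBl -dj mulrBr exprSr !mulrA opprB addrCA subrr addr0 //.
Qed.

Lemma diffop_ore (d : D) k : exists p : D * nat, s ^+ p.2 * d = p.1 * s ^+ k.
Proof.
elim: k => [|k [[d1 j1] /= e1]].
  by exists (d, 0%N); rewrite /= mul1r mulr1.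
have [[d2 j2] /= e2] := diffop_ore1 d1.
by exists (d2, (j2 + j1)%N); rewrite /= exprD -mulrA e1 mulrA e2 -mulrA exprS.
Qed.

Lemma diffop_ore_rev1 (d : D) : d * s = 0 -> exists j, s ^+ j * d = 0.
Proof.
have [_ [k]] := diffopP d; elim: k d => [|k IH] d ord_d ds0.
  exists 0%N; rewrite mul1r.
  by apply: diffopE => x; rewrite ord_d.
have [||j dj] := IH (d * s - s * d).
- exact: ord_d.
- by rewrite ds0 sub0r mulNr -mulrA ds0 mulr0 oppr0.
exists j.+1; move: dj; rewrite ds0 sub0r mulrN => /eqP.
by rewrite oppr_eq0 mulrA -exprSr => /eqP.
Qed.

Lemma diffop_ore_rev (d : D) k : d * s ^+ k = 0 -> exists j, s ^+ j * d = 0.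
Proof.
elim: k d => [|k IH] d; first by rewrite mulr1 => ->; exists 0%N; rewrite mulr0.
rewrite exprSr mulrA => /diffop_ore_rev1[j]; rewrite mulrA => /IH[l el].
by exists (l + j)%N; rewrite exprD -mulrA.
Qed.

Variable M : lmodType D.

Definition loc_eq (u v : M * nat) : bool :=
  `[< exists j, s ^+ j *: (s ^+ v.2 *: u.1 - s ^+ u.2 *: v.1) = 0 >].

Lemma loc_eqP m k m' k' :
  reflect (exists j, s ^+ (j + k') *: m = s ^+ (j + k) *: m')
          (loc_eq (m, k) (m', k')).
Proof.
apply: (iffP (asboolP _)) => -[j] /= e; exists j; apply/eqP; move/eqP: e.
  by rewrite scalerBr !scalerA -!exprD subr_eq0.
by rewrite -subr_eq0 => e; rewrite scalerBr !scalerA -!exprD.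
Qed.

Lemma loc_eq_is_equiv : equiv_class_of loc_eq.
Proof.
have loc_sym : forall u v, loc_eq u v -> loc_eq v u.
  by case=> [m k] [m' k'] /loc_eqP[j e]; apply/loc_eqP; exists j.
split=> [[m k]|u v|[m2 k2] [m1 k1] [m3 k3]].
- by apply/loc_eqP; exists 0%N.
- by apply/idP/idP; apply: loc_sym.
move=> /loc_eqP[i e] /loc_eqP[j e']; apply/loc_eqP; exists (i + j + k2)%N.
have -> : (i + j + k2 + k3 = (j + k3) + (i + k2))%N by lia.
have -> : (i + j + k2 + k1 = (i + k1) + (j + k2))%N by lia.
by rewrite exprD -scalerA e scalerA -exprD addnC exprD -scalerA e' scalerA -exprD.
Qed.

Canonical loc_eq_equiv := EquivRelPack loc_eq_is_equiv.
Canonical loc_eq_encModRel := defaultEncModRel loc_eq.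

Definition locmod : Type := {eq_quot loc_eq}.

HB.instance Definition _ : EqQuotient (M * nat)%type loc_eq locmod :=
  EqQuotient.on locmod.
HB.instance Definition _ := Choice.on locmod.

Definition lfrac (m : M) (k : nat) : locmod := \pi_locmod (m, k).

Lemma lfrac_eqP m k m' k' :
  lfrac m k = lfrac m' k' <->
  exists j, s ^+ (j + k') *: m = s ^+ (j + k) *: m'.
Proof.
split.
  by move=> /eqP; rewrite /lfrac eqmodE => /loc_eqP.
by move=> /loc_eqP H; apply/eqP; rewrite /lfrac eqmodE.
Qed.

Lemma lfracE (u : locmod) : lfrac (repr u).1 (repr u).2 = u.
Proof. by rewrite /lfrac -surjective_pairing reprK. Qed.

Lemma lfracP (u : locmod) : exists m k, u = lfrac m k.
Proof. by exists (repr u).1, (repr u).2; rewrite lfracE. Qed.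

Lemma lfracS j m k : lfrac (s ^+ j *: m) (j + k) = lfrac m k.
Proof.
by apply/lfrac_eqP; exists 0%N; rewrite !scalerA -!exprD !add0n addnC.
Qed.

Definition locmod0 : locmod := lfrac 0 0.
Definition locmodN (u : locmod) : locmod := lfrac (- (repr u).1) (repr u).2.
Definition locmodD (u v : locmod) : locmod :=
  lfrac (s ^+ (repr v).2 *: (repr u).1 + s ^+ (repr u).2 *: (repr v).1)
        ((repr u).2 + (repr v).2).
Definition locmodZ (d : D) (u : locmod) : locmod :=
  let p := projT1 (cid (diffop_ore d (repr u).2)) in
  lfrac (p.1 *: (repr u).1) p.2.

Lemma spow_scale i j (m : M) : s ^+ i *: (s ^+ j *: m) = s ^+ (i + j) *: m.
Proof. by rewrite scalerA -exprD. Qed.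

Lemma lfracD m k m' k' :
  locmodD (lfrac m k) (lfrac m' k') = lfrac (s ^+ k' *: m + s ^+ k *: m') (k + k').
Proof.
have /lfrac_eqP[i ei] := lfracE (lfrac m k).
have /lfrac_eqP[j ej] := lfracE (lfrac m' k').
rewrite /locmodD; apply/lfrac_eqP; exists (i + j)%N.
move: (repr (lfrac m k)) (repr (lfrac m' k')) ei ej => [a p] [b q] /= ei ej.
rewrite !scalerDr !spow_scale.
have -> : (i + j + (k + k') + q = (j + k' + q) + (i + k))%N by lia.
have -> : (i + j + (k + k') + p = (i + k + p) + (j + k'))%N by lia.
rewrite -!(spow_scale _ (i + k)) -!(spow_scale _ (j + k')) ei ej !spow_scale.
by congr (s ^+ _ *: _ + s ^+ _ *: _); lia.
Qed.

Lemma lfracD_same m m' k : locmodD (lfrac m k) (lfrac m' k) = lfrac (m + m') k.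
Proof. by rewrite lfracD -scalerDr lfracS. Qed.

Lemma lfracZ_indep d d' e j l k (m : M) :
    s ^+ j * d = d' * s ^+ k -> s ^+ l * d = e * s ^+ k ->
  lfrac (d' *: m) j = lfrac (e *: m) l.
Proof.
move=> Hj Hl.
have [|i ei] := @diffop_ore_rev (s ^+ l * d' - s ^+ j * e) k.
  by rewrite mulrBl -!mulrA -Hj -Hl !mulrA -!exprD addnC subrr.
apply/lfrac_eqP; exists i; rewrite !scalerA !exprD.
apply/eqP; rewrite -subr_eq0 -scalerBl -!mulrA -mulrBr ei scale0r //.
Qed.

Lemma lfracZ d d' j m k :
  s ^+ j * d = d' * s ^+ k -> locmodZ d (lfrac m k) = lfrac (d' *: m) j.
Proof.
move=> Hj; rewrite /locmodZ; case: (cid _) => -[e l] /= Hl.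
have /lfrac_eqP[i ei] := lfracE (lfrac m k).
move: (repr (lfrac m k)) Hl ei => [a p] /= Hl ei.
have [[g q] /= Hq] := diffop_ore d (i + p + k).
rewrite (@lfracZ_indep d e (g * s ^+ (i + k)) l q p) //; last first.
  by rewrite Hq -mulrA -exprD; congr (_ * s ^+ _); lia.
rewrite (@lfracZ_indep d d' (g * s ^+ (i + p)) j q k) //; last first.
  by rewrite Hq -mulrA -exprD; congr (_ * s ^+ _); lia.
by rewrite -!scalerA ei.
Qed.

Lemma lfracP2 u v : exists m m' k, u = lfrac m k /\ v = lfrac m' k.
Proof.
have [m [k ->]] := lfracP u; have [m' [k' ->]] := lfracP v.
exists (s ^+ k' *: m), (s ^+ k *: m'), (k' + k)%N.
by split; [rewrite lfracS | rewrite addnC lfracS].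
Qed.

Fact locmod_addA : associative locmodD.
Proof.
move=> u v w; have [m [m' [k [-> ->]]]] := lfracP2 u v.
have [n [l ->]] := lfracP w.
rewrite lfracD_same -(lfracS l m) -(lfracS l m') -(lfracS l (m + m')).
rewrite -(lfracS k n) [(k + l)%N]addnC !lfracD_same scalerDr.
by rewrite addrA.
Qed.
Fact locmod_addC : commutative locmodD.
Proof.
move=> u v; have [m [m' [k [-> ->]]]] := lfracP2 u v.
by rewrite !lfracD_same addrC.
Qed.
Fact locmod_add0 : left_id locmod0 locmodD.
Proof.
move=> u; have [m [k ->]] := lfracP u.
by rewrite /locmod0 -(lfracS k 0 0) addn0 scaler0 lfracD_same add0r.
Qed.
Fact locmod_addN : left_inverse locmod0 locmodN locmodD.
Proof.
move=> u; rewrite -{2}(lfracE u) /locmodN lfracD_same addNr.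
by rewrite /locmod0 -(lfracS (repr u).2 0 0) addn0 scaler0.
Qed.

HB.instance Definition _ := GRing.isZmodule.Build locmod
  locmod_addA locmod_addC locmod_add0 locmod_addN.

Fact locmod_scaleA d e u : locmodZ d (locmodZ e u) = locmodZ (d * e) u.
Proof.
have [m [k ->]] := lfracP u.
have [[e' j] /= He] := diffop_ore e k; have [[d' l] /= Hd] := diffop_ore d j.
rewrite (lfracZ m He) (lfracZ _ Hd) (@lfracZ _ (d' * e') l) ?scalerA //.
by rewrite mulrA Hd -!mulrA He.
Qed.
Fact locmod_scale1 : left_id 1 locmodZ.
Proof.
move=> u; have [m [k ->]] := lfracP u.
by rewrite (@lfracZ _ 1 k) ?scale1r ?mulr1 ?mul1r.
Qed.
Fact locmod_scaleDr : right_distributive locmodZ +%R.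
Proof.
move=> d u v; have [m [m' [k [-> ->]]]] := lfracP2 u v.
have [[d' j] /= Hd] := diffop_ore d k.
by rewrite [X in locmodZ d X]lfracD_same !(lfracZ _ Hd) [RHS]lfracD_same scalerDr.
Qed.
Fact locmod_scaleDl u : {morph locmodZ^~ u : d e / d + e}.
Proof.
move=> d e; have [m [k ->]] := lfracP u.
have [[d' j] /= Hd] := diffop_ore d k; have [[e' l] /= He] := diffop_ore e k.
have Hd2 : s ^+ (j + l) * d = (s ^+ l * d') * s ^+ k.
  by rewrite addnC exprD -mulrA Hd mulrA.
have He2 : s ^+ (j + l) * e = (s ^+ j * e') * s ^+ k.
  by rewrite exprD -mulrA He mulrA.
rewrite (lfracZ m Hd2) (lfracZ m He2) [RHS]lfracD_same -scalerDl.
by apply: lfracZ; rewrite mulrDr Hd2 He2 mulrDl.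
Qed.

HB.instance Definition _ := GRing.Zmodule_isLmodule.Build D locmod
  locmod_scaleA locmod_scale1 locmod_scaleDr locmod_scaleDl.

Lemma lfrac_scale d d' j m k :
  s ^+ j * d = d' * s ^+ k -> d *: lfrac m k = lfrac (d' *: m) j.
Proof. exact: lfracZ. Qed.

Definition loc_map (m : M) : locmod := lfrac m 0.

Lemma loc_map_linear : linear loc_map.
Proof.
move=> d m m'; rewrite (@lfrac_scale d d 0) ?mulr1 ?mul1r //.
by rewrite [RHS]lfracD_same.
Qed.

HB.instance Definition _ := GRing.isLinear.Build D M locmod _ loc_map loc_map_linear.

Lemma loc_map_eq0 m : loc_map m = 0 <-> exists j, s ^+ j *: m = 0.
Proof.
split=> [/lfrac_eqP[j] | [j e]].
  by rewrite scaler0 addn0 => e; exists j.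
by apply/lfrac_eqP; exists j; rewrite scaler0 addn0.
Qed.

Lemma lfrac_loc_map m k : s ^+ k *: lfrac m k = loc_map m.
Proof. by rewrite (@lfrac_scale _ 1 0) ?scale1r. Qed.

Lemma locmod_f_inj : injective (fun u : locmod => s *: u).
Proof.
move=> u v; have [m [m' [k [-> ->]]]] := lfracP2 u v.
have E m1 : s *: lfrac m1 k = lfrac (s *: m1) k.
  by apply: lfrac_scale; rewrite -exprSr -exprS.
rewrite /= !E => /lfrac_eqP[j e]; apply/lfrac_eqP; exists j.+1.
by move: e; rewrite !scalerA -!exprSr.
Qed.

End Localization.

Definition prime_chain (A : comNzRingType) (d : nat) (P : nat -> {pred A}) : Prop :=
  (forall i, (i <= d)%N -> idealr_closed (P i) /\ prime_idealr_closed (P i)) /\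
  (forall i, (i < d)%N -> {subset P i <= P i.+1} /\ ~ {subset P i.+1 <= P i}).

Definition krull_dim (A : comNzRingType) (r : nat) : Prop :=
  (exists P, @prime_chain A r P) /\
  (forall d, (exists P, @prime_chain A d P) -> (d <= r)%N).

Section Restriction.
Variables (K : fieldType) (D : lalgType K) (M : lmodType D).

Definition restrict_scalars : Type := M.

HB.instance Definition _ := GRing.Zmodule.on restrict_scalars.

Let scaleK (c : K) (m : restrict_scalars) : restrict_scalars := c%:A *: (m : M).

Fact scaleK_A a b m : scaleK a (scaleK b m) = scaleK (a * b) m.
Proof. by rewrite /scaleK !scalerA -scalerAl mul1r scalerA. Qed.
Fact scaleK_1 : left_id 1 scaleK.
Proof. by move=> m; rewrite /scaleK !scale1r. Qed.
Fact scaleK_Dr : right_distributive scaleK +%R.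
Proof. by move=> c m m'; rewrite /scaleK scalerDr. Qed.
Fact scaleK_Dl m : {morph scaleK^~ m : a b / a + b}.
Proof. by move=> a b; rewrite /scaleK !scalerDl. Qed.

HB.instance Definition _ := GRing.Zmodule_isLmodule.Build K restrict_scalars
  scaleK_A scaleK_1 scaleK_Dr scaleK_Dl.

End Restriction.

Definition has_dim (K : fieldType) (V : lmodType K) (W : {pred V}) (d : nat) : Prop :=
  exists b : 'I_d -> V,
    (forall v, v \in W <-> exists c : 'I_d -> K, v = \sum_i c i *: b i) /\
    (forall c : 'I_d -> K, \sum_i c i *: b i = 0 -> forall i, c i = 0).

Record simplicial_complex (n : nat) := SimplicialComplex {
  faces :> {set {set 'I_n}};
  face_set0 : set0 \in faces;
  face_subset : forall F G : {set 'I_n}, G \subset F -> F \in faces -> G \in faces;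
  face_set1 : forall i : 'I_n, [set i] \in faces
}.

Definition facet n (Delta : simplicial_complex n) (H : {set 'I_n}) : bool :=
  maxset [pred F | F \in faces Delta] H.

Definition T_space n (Delta : simplicial_complex n) : Prop :=
  forall F G : {set 'I_n}, F \in faces Delta -> G \in faces Delta ->
    ~~ (G \subset F) ->
    exists H, [/\ facet Delta H, F \subset H & ~~ (G \subset H)].

Section FaceRing.
Variables (K : fieldType) (n : nat) (Delta : simplicial_complex n).

Local Notation S := {mpoly K[n]}.

Definition face_ideal : {pred S} := fun p : S =>
  `[< exists c : {set 'I_n} -> S,
        p = \sum_(F | F \notin faces Delta) c F * \prod_(i in F) 'X_i >].

Lemma face_idealP (p : S) :
  reflect (exists c : {set 'I_n} -> S,
             p = \sum_(F | F \notin faces Delta) c F * \prod_(i in F) 'X_i)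
          (p \in face_ideal).
Proof. exact: asboolP. Qed.

Fact face_ideal_closed : idealr_closed face_ideal.
Proof.
split.
- apply/face_idealP; exists (fun=> 0).
  by rewrite big1 // => F _; rewrite mul0r.
- apply/negP => /face_idealP[c /(congr1 (meval (fun=> 0)))].
  rewrite rmorph1 raddf_sum big1 /=; first by move/eqP; rewrite oner_eq0.
  move=> F notF; have [F0|[i Fi]] := set_0Vmem F.
    by rewrite F0 face_set0 in notF.
  by rewrite (bigD1 i) //= !rmorphM /= mevalXU mul0r mulr0.
- move=> a u v /face_idealP[c ->] /face_idealP[c' ->]; apply/face_idealP.
  exists (fun F => a * c F + c' F).
  rewrite mulr_sumr -big_split; apply: eq_bigr => F _ /=.
  by rewrite mulrDl mulrA.
Qed.

HB.instance Definition _ := isIdealr.Build S face_ideal face_ideal_closed.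

Definition face_ring : Type := {ideal_quot face_ideal}.

HB.instance Definition _ := GRing.ComNzRing.on face_ring.

Definition face_pi : S -> face_ring := \pi_{ideal_quot face_ideal}.

Fact face_pi_zmod_morphism : zmod_morphism face_pi.
Proof. exact: (rmorphB \pi_{ideal_quot face_ideal}). Qed.
Fact face_pi_monoid_morphism : monoid_morphism face_pi.
Proof. by split; [apply: rmorph1 | apply: rmorphM]. Qed.
HB.instance Definition _ :=
  GRing.isZmodMorphism.Build S face_ring face_pi face_pi_zmod_morphism.
HB.instance Definition _ :=
  GRing.isMonoidMorphism.Build S face_ring face_pi face_pi_monoid_morphism.

Let face_scale (c : K) (x : face_ring) : face_ring := face_pi c%:MP * x.

Fact face_scaleA a b x : face_scale a (face_scale b x) = face_scale (a * b) x.
Proof. by rewrite /face_scale mulrA mpolyCM rmorphM. Qed.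
Fact face_scale1 : left_id 1 face_scale.
Proof. by move=> x; rewrite /face_scale rmorph1 mul1r. Qed.
Fact face_scaleDr : right_distributive face_scale +%R.
Proof. by move=> c x y; rewrite /face_scale mulrDr. Qed.
Fact face_scaleDl x : {morph face_scale^~ x : a b / a + b}.
Proof. by move=> a b; rewrite /face_scale mpolyCD rmorphD mulrDl. Qed.
HB.instance Definition _ := GRing.Zmodule_isLmodule.Build K face_ring
  face_scaleA face_scale1 face_scaleDr face_scaleDl.

Fact face_scaleAl (c : K) (x y : face_ring) : c *: (x * y) = c *: x * y.
Proof. exact: mulrA. Qed.
HB.instance Definition _ := GRing.Lmodule_isLalgebra.Build K face_ring face_scaleAl.
HB.instance Definition _ := GRing.Lalgebra_isComAlgebra.Build K face_ring.

Local Notation R := (face_ring : comAlgType K).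
Local Notation D := (diffop R).

(* When m i < t the binomial coefficient vanishes, so the truncated
   subtraction of exponents is harmless. *)
Definition divderiv (i : 'I_n) (t : nat) (p : S) : S :=
  \sum_(m <- msupp p) p@_m *: ('C(m i, t)%:R *: 'X_[(m - U_(i) *+ t)%MM]).

Definition mono_op (a t : 'X_{1..n}) (p : S) : S :=
  'X_[a] * foldr (fun i => divderiv i (t i)) p (enum 'I_n).

Definition bernstein_span (j : nat) (h : S -> S) : Prop :=
  exists s : seq (K * ('X_{1..n} * 'X_{1..n})),
    (forall u, u \in s -> (mdeg u.2.1 + mdeg u.2.2 <= j)%N) /\
    (forall p, h p = \sum_(u <- s) u.1 *: mono_op u.2.1 u.2.2 p).

(* Under D(R;K) = I(J)/J D(S;K), the class of h in I(J) is the operator that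
   h induces on R = S/J. *)
Definition bernstein (j : nat) (d : D) : Prop :=
  exists h : diffop S,
    [/\ forall p, p \in face_ideal -> h p \in face_ideal,
        bernstein_span j h
      & forall p, d (face_pi p) = face_pi (h p)].

Definition K_filtration (M : lmodType D) (G : nat -> {pred restrict_scalars M}) : Prop :=
  [/\ forall i, submod_closed (G i),
      forall i, {subset G i <= G i.+1},
      forall m, exists i, m \in G i
    & forall j i (d : D) (m : M),
        bernstein j d -> m \in G i -> d *: m \in G (i + j)%N].

Definition holonomic (M : lmodType D) : Prop :=
  exists r, krull_dim R r /\
  exists (G : nat -> {pred restrict_scalars M}) (C : nat),
    K_filtration G /\
    forall i, exists d, has_dim (G i) d /\ (d <= C * i ^ r)%N.

End FaceRing.

(* Main.v *)
Require Import Defs.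
From HB Require Import structures.
From mathcomp Require Import all_boot all_order all_algebra.
From mathcomp Require Import generic_quotient.
From mathcomp Require Import ssrcomplements mpoly.
From mathcomp Require Import boolp zify.

Set Implicit Arguments.
Unset Strict Implicit.
Unset Printing Implicit Defensive.

Import GRing.Theory.
Local Open Scope ring_scope.

(** Let G be a filtration of M with dim G_i <= C i^r, and let e be an integer
    such that multiplication by f lies in the Bernstein piece F_e.  The
    localization is filtered by
      G'_k = { m / f^k | m in G_(k (e + 1)) }.
    This chain ascends because m / f^k = f m / f^(k+1) and f raises the
    filtration degree by e only.  It exhausts M_f because f^i m / f^(i+k), with
    m in G_i, has numerator in G_(i + i e).  Its growth is polynomial of the
    same degree r, since G'_k is a quotient of G_(k (e + 1)):
    dim G'_k <= C (e + 1)^r k^r.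

    What remains is F_j G'_k <= G'_(k+j).  It rests on two facts.  First, an
    operator in F_j has order at most j in the commutator sense
    ([bernstein_order]): the divided power of exponent t along one variable has
    order at most t, because its commutator with that variable is the divided
    power of exponent t - 1, and commutators with the variables control
    commutators with all polynomials.  Second, an operator d of order at most j
    satisfies a quantitative Ore condition f^(k+j) d = d' f^k, where d' is a
    combination of products of one factor d and j factors f ([ore_shifts]).
    Hence d (m / f^k) = d' m / f^(k+j), and d' raises the filtration degree by
    at most j + j e, which is exactly what the step from k (e + 1) to
    (k + j) (e + 1) permits. *)

(** * Orders of operators *)

Section Order.
Variables (K : fieldType) (A : comAlgType K).

Lemma diff_ord_mull k (b : A) (h : A -> A) :
  diff_ord k h -> diff_ord k (fun x => b * h x).
Proof.
elim: k h => [|k IH] h /= H; first by move=> x; rewrite H mulr0.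
by move=> a; apply: (diff_ord_ext _ (IH _ (H a))) => x; rewrite mulrBr mulrCA.
Qed.

Lemma diff_ord_mulr k (b : A) (h : A -> A) :
  diff_ord k h -> diff_ord k (fun x => h (b * x)).
Proof.
elim: k h => [|k IH] h /= H; first by move=> x; rewrite H.
by move=> a; apply: (diff_ord_ext _ (IH _ (H a))) => x; rewrite [b * (a * x)]mulrCA.
Qed.

(** Composing operators of orders at most k and l gives order at most k + l.
    The bound k + l + 1 that results from counting strict bounds naively would
    accumulate one unit per variable and lose the inequality between order and
    Bernstein degree. *)
Lemma diff_ord_comp_sharp k l (h h' : A -> A) :
    (forall x y, h (x - y) = h x - h y) ->
  diff_ord k.+1 h -> diff_ord l h' -> diff_ord (k + l) (fun x => h (h' x)).
Proof.
have [m] := ubnP (k + l)%N; elim: m k l h h' => [|m IH] // k l h h' lt_m hB.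
have h0 : h 0 = 0 by have := hB 0 0; rewrite !subrr.
case: l lt_m => [|l] lt_m H H'.
  by apply: (diff_ord_le (leq0n _)) => x; rewrite H' h0.
rewrite addnS /= => a.
have H1 : diff_ord (k + l) (fun x => h (h' (a * x) - a * h' x)).
  by apply: IH => //; rewrite addnS ltnS in lt_m.
have H2 : diff_ord (k + l) (fun x => h (a * h' x) - a * h (h' x)).
  case: k lt_m H {H1} => [|k] lt_m H.
    by apply: (diff_ord_le (leq0n _)) => x; apply: (H a).
  rewrite addSnnS.
  apply: (IH _ _ (fun x => h (a * x) - a * h x)) => //.
  by move=> x y; rewrite mulrBr !hB mulrBr !opprD opprK addrACA.
by apply: (diff_ord_ext _ (diff_ordD H1 H2)) => x; rewrite hB addrA subrK.
Qed.

End Order.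

(** Orders descend along quotients, since every commutator downstairs lifts. *)
Lemma diff_ord_surj (A B : pzRingType) (phi : {rmorphism A -> B})
    (h : A -> A) (d : B -> B) k :
    (forall b, exists a, phi a = b) -> (forall x, d (phi x) = phi (h x)) ->
  diff_ord k h -> diff_ord k d.
Proof.
move=> phi_surj; elim: k h d => [|k IH] h d hd /= H b.
  by have [a <-] := phi_surj b; rewrite hd H rmorph0.
have [a <-] := phi_surj b; apply: (IH _ _ _ (H a)) => x.
by rewrite rmorphB !rmorphM /= -!hd rmorphM.
Qed.

(** * Divided powers and the order of polynomial operators *)

Section PolyOrder.
Variables (K : fieldType) (n : nat).
Local Notation S := {mpoly K[n]}.

Lemma eq_linear_monomials (V : lmodType K) (u v : {linear S -> V}) :
  (forall m, u 'X_[m] = v 'X_[m]) -> u =1 v.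
Proof.
move=> uv p; rewrite [p]mpolyE !linear_sum; apply: eq_bigr => m _.
by rewrite !linearZ uv.
Qed.

(** The elements a for which the commutator of h with a has order < k form a
    subalgebra: [h, a b] = [h, a] b + a [h, b]. *)
Lemma diff_ord_generators k (h : S -> S) : linear h ->
    (forall i, diff_ord k (fun p => h ('X_i * p) - 'X_i * h p)) ->
  diff_ord k.+1 h.
Proof.
move=> lin_h hX.
have hD p q : h (p + q) = h p + h q by rewrite -[p]scale1r lin_h !scale1r.
have h0 : h 0 = 0 by apply: (addrI (h 0)); rewrite -hD !addr0.
have hZ c p : h (c *: p) = c *: h p by rewrite -[c *: p]addr0 lin_h h0 addr0.
pose B a := diff_ord k (fun p => h (a * p) - a * h p).
have B1 : B 1 by apply: diff_ord_ext (diff_ord0 _ k) => x; rewrite !mul1r subrr.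
have BM a b : B a -> B b -> B (a * b).
  move=> Ba Bb.
  apply: (diff_ord_ext _ (diff_ordD (diff_ord_mulr b Ba) (diff_ord_mull a Bb))).
  by move=> x /=; rewrite mulrBr !mulrA addrA subrK.
have BD c a b : B a -> B b -> B (c *: a + b).
  move=> Ba Bb; apply: (diff_ord_ext _ (diff_ordD (diff_ordZ c Ba) Bb)) => x /=.
  by rewrite !mulrDl hD -!scalerAl hZ scalerBr opprD addrACA.
have BX m : B 'X_[m].
  rewrite mpolyXE_id; elim/big_ind: _ => // i _.
  by elim: (m i) => [|j IH]; rewrite ?expr0 // exprS; apply: BM.
move=> a; rewrite -/(B a); elim/mpolyind: a => [|c m p _ _ Bp]; last exact: BD.
by apply: diff_ord_ext (diff_ord0 _ k) => x; rewrite !mul0r h0 subrr.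
Qed.

(** A common summation range for several polynomials, which makes linearity
    visible. *)
Lemma divderivwE (i : 'I_n) t (p : S) k : (msize p <= k)%N ->
  divderiv i t p =
    \sum_(m : 'X_{1..n < k}) p@_m *: ('C(m i, t)%:R *: 'X_[(m - U_(i) *+ t)%MM]).
Proof.
pose I : subFinType _ := 'X_{1..n < k}.
move=> le_pk; rewrite /divderiv (big_mksub I) /=; first last.
- by move=> m /msize_mdeg_lt/leq_trans/(_ le_pk).
- by rewrite msupp_uniq.
by rewrite big_rmcond //= => j /memN_msupp_eq0 ->; rewrite scale0r.
Qed.

Fact divderiv_linear (i : 'I_n) t : linear (divderiv (K := K) i t).
Proof.
move=> c p q; pose k := maxn (msize (c *: p + q)) (maxn (msize p) (msize q)).
rewrite (@divderivwE _ _ p k) ?(@divderivwE _ _ q k) ?(@divderivwE _ _ _ k);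
  do ?by rewrite !leq_max leqnn ?orbT.
rewrite scaler_sumr -big_split /=; apply: eq_bigr => m _.
by rewrite mcoeffD mcoeffZ scalerDl -scalerA.
Qed.
HB.instance Definition _ i t :=
  GRing.isLinear.Build K S S _ (divderiv i t) (divderiv_linear i t).

Lemma divderivX (i : 'I_n) t m :
  divderiv i t ('X_[m] : S) = 'C(m i, t)%:R *: 'X_[(m - U_(i) *+ t)%MM].
Proof. by rewrite /divderiv msuppX big_seq1 mcoeffX eqxx scale1r. Qed.

Lemma divderiv0 (i : 'I_n) (p : S) : divderiv i 0 p = p.
Proof.
apply: (eq_linear_monomials (u := divderiv i 0) (v := idfun)) => m /=.
by rewrite divderivX bin0 scale1r mulm0n subm0.
Qed.

(** Pascal's rule, read as a commutation relation. *)
Lemma divderiv_commutator (i k : 'I_n) t (p : S) :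
  divderiv i t.+1 ('X_k * p) - 'X_k * divderiv i t.+1 p =
    (i == k)%:R *: divderiv i t p.
Proof.
elim/mpolyind: p => [|c m p _ _ IH].
  by rewrite mulr0 !linear0 mulr0 subr0.
rewrite mulrDr -scalerAr !divderiv_linear mulrDr -scalerAr opprD addrACA.
rewrite -scalerBr IH [RHS]scalerDr scalerA [_%:R * c]mulrC -scalerA.
congr (c *: _ + _).
rewrite -mpolyXD !divderivX -scalerAr -mpolyXD mnmDE mnm1E eq_sym.
have [<-|ki] := eqVneq i k; last first.
  rewrite add0n scale0r; apply/eqP; rewrite subr_eq0; apply/eqP.
  congr (_ *: 'X_[_]); apply/mnmP => j; rewrite !(mnmBE, mnmDE, mulmnE, mnm1E).
  by case: (eqVneq k j) => [<-|_]; rewrite ?(negbTE ki) ?mul0n ?subn0.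
rewrite add1n binS natrD scalerDl scale1r.
have -> : (U_(i) + m - U_(i) *+ t.+1 = m - U_(i) *+ t)%MM.
  apply/mnmP => j; rewrite !(mnmBE, mnmDE, mulmnE, mnm1E).
  by case: (i == j); rewrite ?mul0n ?subn0 // !mul1n add1n subSS.
(* For m i <= t the exponent m - (t + 1) U_i is truncated, but then its
   coefficient 'C(m i, t.+1) vanishes. *)
have [lt_mt|le_tm] := ltnP (m i) t.+1.
  by rewrite bin_small // !scale0r add0r subr0.
have -> : (U_(i) + (m - U_(i) *+ t.+1) = m - U_(i) *+ t)%MM.
  apply/mnmP => j; rewrite !(mnmBE, mnmDE, mulmnE, mnm1E).
  by case: eqVneq => [<-|_]; rewrite ?mul0n ?subn0 // !mul1n; lia.
by rewrite addrAC subrr add0r.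
Qed.

Lemma divderiv_order (i : 'I_n) t : diff_ord t.+1 (divderiv (K := K) i t).
Proof.
elim: t => [|t IH].
  by move=> a p; rewrite !divderiv0 subrr.
apply: diff_ord_generators => [|k]; first exact: divderiv_linear.
apply: (diff_ord_ext _ (diff_ordZ (i == k)%:R IH)) => p.
by rewrite divderiv_commutator.
Qed.

Lemma mono_op_order (a t : 'X_{1..n}) :
  diff_ord (mdeg t).+1 (mono_op (K := K) a t).
Proof.
apply: diff_ord_mull; rewrite mdegE -big_enum /=.
pose h r (p : S) := foldr (fun j => divderiv j (t j)) p r.
suff h_ord r : diff_ord (\sum_(j <- r) t j).+1 (h r) by apply: h_ord.
pose ord r := diff_ord (\sum_(j <- r) t j).+1 (h r).
rewrite -/(ord r); elim: r => [|i r IH].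
  by rewrite /ord big_nil => b p; rewrite subrr.
rewrite /ord big_cons -addnS.
exact: (diff_ord_comp_sharp (raddfB (divderiv i (t i))) (divderiv_order i (t i)) IH).
Qed.

Lemma bernstein_span_order j (h : S -> S) :
  bernstein_span j h -> diff_ord j.+1 h.
Proof.
case=> s [s_le h_s].
apply: (diff_ord_ext (h := fun p => \sum_(u <- s) u.1 *: mono_op u.2.1 u.2.2 p)).
  by move=> p; rewrite h_s.
elim: s s_le {h_s} => [|u s IH] s_le.
  by apply: diff_ord_ext (diff_ord0 _ _) => p; rewrite big_nil.
apply: (diff_ord_ext (h := fun p => u.1 *: mono_op u.2.1 u.2.2 p +
    \sum_(v <- s) v.1 *: mono_op v.2.1 v.2.2 p)).
  by move=> p; rewrite big_cons.
apply: diff_ordD; last by apply: IH => v vs; apply: s_le; rewrite inE vs orbT.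
apply: diff_ordZ; apply: diff_ord_le (mono_op_order _ _).
by apply: leq_trans (s_le u _); rewrite ?leq_addl // mem_head.
Qed.

(** Multiplication by p is a combination of the operators x^m with no
    derivative; [msize p] bounds their degrees. *)
Lemma bernstein_span_mul (p : S) : bernstein_span (msize p) (fun q => p * q).
Proof.
exists [seq (p@_m, (m, 0%MM)) | m <- msupp p]; split=> [u|q].
  by case/mapP=> m /msize_mdeg_lt/ltnW lt_m -> /=; rewrite mdeg0 addn0.
rewrite big_map {1}[p]mpolyE mulr_suml; apply: eq_bigr => m _.
rewrite -scalerAl /mono_op /=; congr (_ *: (_ * _)).
by elim: (enum _) => //= i r <-; rewrite mnm0E divderiv0.
Qed.

End PolyOrder.

(** * Operators on the face ring *)

Section FaceRingOperators.
Variables (K : fieldType) (n : nat) (Delta : simplicial_complex n).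
Local Notation R := (face_ring K Delta : comAlgType K).
Local Notation S := {mpoly K[n]}.

Lemma face_pi_surj (x : face_ring K Delta) : exists p : S, face_pi Delta p = x.
Proof. by exists (repr x); apply: reprK. Qed.

Lemma bernstein_order j (d : diffop R) : bernstein j d -> diff_ord j.+1 d.
Proof.
case=> h [_ span_h dh]; apply: diff_ord_surj (bernstein_span_order span_h).
- exact: face_pi_surj.
- exact: dh.
Qed.

Lemma bernstein_mul (f : face_ring K Delta) :
  exists e, bernstein e (diffop_mul f : diffop R).
Proof.
have [p <-] := face_pi_surj f; exists (msize p), (diffop_mul p); split=> [q Iq||q].
- by rewrite /= -[p * q]addr0; case: (face_ideal_closed K Delta) => I0 _; apply.
- exact: bernstein_span_mul.
- by rewrite /= rmorphM.
Qed.

End FaceRingOperators.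

(** * Dimension of a spanned subspace *)

Section Spanning.
Variables (K : fieldType) (V : lmodType K).

Lemma span_has_dim d (W : {pred V}) (b : 'I_d -> V) :
    (forall v, v \in W <-> exists c : 'I_d -> K, v = \sum_i c i *: b i) ->
  exists d', has_dim W d' /\ (d' <= d)%N.
Proof.
elim: d b => [|d IH] b Wb.
  by exists 0%N; split=> //; exists b; split=> // c _ [].
have [free|/existsNP[c /not_implyP[c0 /existsNP[k /eqP ck]]]] :=
  pselect (forall c : 'I_d.+1 -> K, \sum_i c i *: b i = 0 -> forall i, c i = 0).
  by exists d.+1; split=> //; exists b.
have bk : b k = \sum_i (- (c k)^-1 * c (lift k i)) *: b (lift k i).
  apply: (scalerI ck); rewrite scaler_sumr; apply/eqP.
  rewrite -subr_eq0 -[X in _ == X]c0 (bigD1_ord k) //= -sumrN; apply/eqP.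
  congr (_ + _); apply: eq_bigr => i _.
  by rewrite scalerA mulNr mulrN mulVKf // scaleNr opprK.
have [|d' [Wd' le_d']] := IH (b \o lift k); last by exists d'; rewrite ltnW.
move=> v; rewrite Wb; split=> -[a ->].
  exists (fun i => a (lift k i) - a k * (c k)^-1 * c (lift k i)).
  rewrite (bigD1_ord k) //= bk scaler_sumr -big_split; apply: eq_bigr => i _.
  by rewrite /= scalerA -scalerDl addrC mulNr mulrN mulrA.
exists (fun i => oapp a 0 (unlift k i)).
rewrite [RHS](bigD1_ord k) //= unlift_none scale0r add0r.
by apply: eq_bigr => i _; rewrite liftK.
Qed.

End Spanning.

(** * The filtration of the localization *)

Section Localization.
Variables (K : fieldType) (n : nat) (Delta : simplicial_complex n).
Local Notation R := (face_ring K Delta : comAlgType K).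
Local Notation D := (diffop R).
Variables (f : face_ring K Delta) (M : lmodType D).
Local Notation s := (diffop_mul f : D).
Variable G : nat -> {pred restrict_scalars M}.
Hypothesis filtG : K_filtration G.

(** Degrees of operators are measured by their action on G, so that products and
    commutators need not be expanded in normal form. *)
Definition shifts c (d : D) :=
  forall p (m : M), m \in G p -> d *: m \in G (p + c)%N.

Lemma filtration_le p q : (p <= q)%N -> {subset G p <= G q}.
Proof.
case: filtG => _ GS _ _ /subnK <-; elim: (q - p)%N => [|k IH] m Gm //.
by rewrite addSn; apply/GS/IH.
Qed.

Lemma filtrationB p (m m' : M) : m \in G p -> m' \in G p -> m - m' \in G p.
Proof.
case: filtG => Gsub _ _ _ Gm Gm'; case: (Gsub p) => _ GZD.
have := GZD (-1) m' m Gm' Gm; rewrite scaleN1r addrC; exact.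
Qed.

Lemma shifts_bernstein j d : bernstein j d -> shifts j d.
Proof. by case: filtG => _ _ _ GF Fd p m; apply: GF. Qed.

Lemma shiftsM c c' d d' : shifts c d -> shifts c' d' -> shifts (c + c') (d * d').
Proof.
move=> sd sd' p m /sd'/sd; rewrite scalerA.
by rewrite -addnA (addnC c').
Qed.

Lemma shiftsB c d d' : shifts c d -> shifts c d' -> shifts c (d - d').
Proof.
by move=> sd sd' p m Gm; rewrite scalerBl; apply: filtrationB; [apply: sd | apply: sd'].
Qed.

Lemma shiftsX c d k : shifts c d -> shifts (k * c) (d ^+ k).
Proof.
move=> sd; elim: k => [|k IH]; first by move=> p m; rewrite scale1r addn0.
by rewrite exprS mulSn; apply: shiftsM.
Qed.

Variable e : nat.
Hypothesis shift_s : shifts e s.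

(** The commutator [d, s] = d s - s d has smaller order, so by induction
    s^(i+1+j) [d, s] = d2 s^(i+1).  Together with s^(i+j+1) d = d1 s^i this gives
      s^(i+j+2) d = s^(i+j+1) (d s - [d, s]) = (d1 - d2) s^(i+1),
    which drives a double induction on the order j and the exponent i. *)
Lemma ore_shifts c j i (d : D) : diff_ord j.+1 d -> shifts c d ->
  exists d', s ^+ (i + j) * d = d' * s ^+ i /\ shifts (c + j * e) d'.
Proof.
elim: j c i d => [|j IHj] c i d ord_d sd.
  exists d; rewrite !addn0; split=> //; apply/esym/(@commrX _ d s).
  apply: diffopE => x /=; apply/eqP; rewrite -subr_eq0; apply/eqP.
  exact: (ord_d f x).
have ord_ds : diff_ord j.+1 (d * s - s * d : D) by exact: ord_d.
have sds : shifts (c + e) (d * s - s * d).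
  by apply: shiftsB; [|rewrite addnC]; apply: shiftsM.
elim: i => [|i [d1 [e1 sd1]]].
  exists (s ^+ j.+1 * d); rewrite mulr1; split=> //.
  by rewrite addnC; apply: shiftsM => //; apply: shiftsX.
have [d2 [e2 sd2]] := IHj _ i.+1 _ ord_ds sds.
exists (d1 - d2); split; last first.
  by apply: shiftsB => //; rewrite mulSn addnA.
rewrite mulrBl -e2 [(i.+1 + j)%N]addSnnS [s ^+ i.+1]exprSr mulrA -e1.
by rewrite mulrBr !mulrA opprB [RHS]addrC subrK -exprSr addSn.
Qed.

(** Stepping by e + 1, rather than by e, pays both for one multiplication by f
    and for one unit of Bernstein degree. *)
Definition loc_filtration (k : nat) : {pred restrict_scalars (locmod f M)} :=
  fun u => `[< exists m : M, m \in G (k * e.+1)%N /\ u = lfrac f m k >].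

Lemma loc_filtrationP k (u : locmod f M) :
  u \in loc_filtration k <-> exists m : M, m \in G (k * e.+1)%N /\ u = lfrac f m k.
Proof. by split=> [/asboolP|?]; last apply/asboolP. Qed.

Lemma lfrac_linear k (c : K) (m m' : M) :
  lfrac f (c%:A *: m + m') k = c%:A *: lfrac f m k + lfrac f m' k.
Proof.
have cs : s ^+ k * c%:A = c%:A * s ^+ k by rewrite -scalerAr -scalerAl mulr1 mul1r.
by rewrite (lfrac_scale m cs) [RHS]lfracD_same.
Qed.

Lemma loc_filtrationK : K_filtration loc_filtration.
Proof.
case: (filtG) => Gsub GS GU GF; split.
- move=> k; case: (Gsub (k * e.+1)%N) => G0 GZD; split.
    apply/loc_filtrationP; exists 0; split=> //.
    by rewrite -[X in lfrac f X](scaler0 _ (s ^+ k)) -[k in lfrac _ _ k]addn0 lfracS.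
  move=> c u v /loc_filtrationP[m [Gm ->]] /loc_filtrationP[m' [Gm' ->]].
  apply/loc_filtrationP; exists (c%:A *: m + m'); split; first exact: GZD.
  by rewrite lfrac_linear.
- move=> k u /loc_filtrationP[m [Gm ->]]; apply/loc_filtrationP.
  exists (s *: m); split; last by rewrite -(lfracS f 1 m k) add1n expr1.
  by apply: filtration_le (shift_s Gm); rewrite mulSn; lia.
- move=> u; have [m [k ->]] := lfracP u; have [i Gm] := GU m.
  exists (i + k)%N; apply/loc_filtrationP; exists (s ^+ i *: m).
  split; last by rewrite lfracS.
  by apply: filtration_le (shiftsX i shift_s Gm); rewrite mulnDl !mulnS; lia.
- move=> j k d u Fd /loc_filtrationP[m [Gm ->]]; apply/loc_filtrationP.
  have [d' [Hd' sd']] := ore_shifts k (bernstein_order Fd) (shifts_bernstein Fd).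
  exists (d' *: m); split; last exact: lfrac_scale.
  by rewrite mulnDl [(j * _)%N]mulnS; apply: sd'.
Qed.

Lemma loc_filtration_dim k d : has_dim (G (k * e.+1)) d ->
  exists d', has_dim (loc_filtration k) d' /\ (d' <= d)%N.
Proof.
case=> b [Gb _]; apply: (@span_has_dim _ _ d _
  (fun i => lfrac f (b i : M) k : restrict_scalars (locmod f M))).
have lfrac_sum c : lfrac f (\sum_i c i *: b i : restrict_scalars M) k =
    (\sum_i c i *: (lfrac f (b i : M) k : restrict_scalars (locmod f M))).
  pose g := (fun m => lfrac f m k) : restrict_scalars M -> restrict_scalars (locmod f M).
  have lin_g : linear g by move=> a m m'; exact: lfrac_linear.
  pose gL := HB.pack g (GRing.isLinear.Build K _ _ _ g lin_g) : {linear _ -> _}.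
  apply: (big_ind2 (fun m u => g m = u)) => [|m u m' u' <- <-|i _].
  - exact: (linear0 gL).
  - exact: (linearD gL).
  - exact: (linearZ_LR gL).
move=> u; rewrite loc_filtrationP; split=> [[m [/Gb[c ->] ->]]|[c ->]].
  by exists c; rewrite lfrac_sum.
exists (\sum_i c i *: b i); rewrite lfrac_sum; split=> //.
by apply/Gb; exists c.
Qed.

End Localization.

Theorem theorem3p11 (K : fieldType) (n : nat) (Delta : simplicial_complex n)
    (hT : T_space Delta) (f : face_ring K Delta)
    (M : lmodType (diffop (face_ring K Delta))) :
  holonomic M -> holonomic (locmod f M).
Proof.
case=> r [dim_r [G [C [filtG dimG]]]]; exists r; split=> //.
have [e Fs] := bernstein_mul f.
exists (loc_filtration (f := f) G e), (C * e.+1 ^ r)%N; split.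
  exact: loc_filtrationK (shifts_bernstein filtG Fs).
move=> k; have [d [dim_d le_d]] := dimG (k * e.+1)%N.
have [d' [dim_d' le_d']] := loc_filtration_dim f dim_d.
exists d'; split=> //; apply: leq_trans le_d' (leq_trans le_d _).
by rewrite expnMn mulnA mulnAC.
Qed.
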